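(* Let $\widehat{A}=A+\varepsilon A_0\in \mathbb{D}^{m\times n}$, $\widehat{B}=B+\varepsilon B_0\in \mathbb{D}^{n\times s}$, $\widehat{C}=C+\varepsilon C_0\in \mathbb{D}^{t\times m}$ be dual matrices, and let $B^+$ and $C^+$ be reflexive inverses of the real matrices $B$ and $C$, respectively. Then the following statements are equivalent: (1) $\widehat{A}^{\|(\widehat{B},\widehat{C})}$ exists; (2) $A^{\|(\widehat{B},\widehat{C})}$ exists; (3) $A^{\|(B,C)}$ exists, $(I-BB^+)B_0(I-B^+B)=0$ and $(I-CC^+)C_0(I-C^+C)=0$. In this case, $$A^{\|(\widehat{B},\widehat{C})}=A^{\|(B,C)}+\varepsilon(I-A^{\|(B,C)}A)B_1A^{\|(B,C)}+\varepsilon A^{\|(B,C)}C_2(I-AA^{\|(B,C)}),$$ $$\widehat{A}^{\|(\widehat{B},\widehat{C})}=A^{\|(B,C)}-\varepsilon A^{\|(B,C)}A_0A^{\|(B,C)}+\varepsilon(I-A^{\|(B,C)}A)B_1A^{\|(B,C)}+\varepsilon A^{\|(B,C)}C_2(I-AA^{\|(B,C)}),$$ where $B_1,B_2,C_1,C_2$ are real matrices of appropriate sizes with $B_0=B_1B+BB_2$ and $C_0=C_1C+CC_2$.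
   Context: $\mathbb{D}=\{a+\varepsilon a_0: a,a_0\in\mathbb{R}\}$ is the ring of dual numbers, $\varepsilon^2=0$, $\varepsilon\ne 0$. A dual matrix $\widehat A\in\mathbb{D}^{m\times n}$ is written $\widehat A=A+\varepsilon A_0$ with $A,A_0\in\mathbb{R}^{m\times n}$; real matrices are viewed as dual matrices with zero dual part. For $\widehat{A}\in \mathbb{D}^{m\times n}$, $\widehat{B}\in \mathbb{D}^{n\times s}$, $\widehat{C}\in \mathbb{D}^{t\times m}$, the $(\widehat B,\widehat C)$-inverse of $\widehat A$, denoted $\widehat{A}^{\|(\widehat{B},\widehat{C})}$, is the (unique, if it exists) $\widehat X\in\mathbb{D}^{n\times m}$ with $\widehat{C}\widehat{A}\widehat{X}=\widehat{C}$, $\widehat{X}\widehat{A}\widehat{B}=\widehat{B}$ and $\widehat{X}=\widehat{B}\widehat{Y}_1=\widehat{Y}_2\widehat{C}$ for some $\widehat{Y}_1\in \mathbb{D}^{s\times m}$, $\widehat{Y}_2\in \mathbb{D}^{n\times t}$. For real matrices, $A^{\|(B,C)}$ is defined in the same way with real matrices throughout. A reflexive inverse of a real matrix $M$ is a real matrix $X$ with $MXM=M$ and $XMX=X$. It is known that $(I-BB^+)B_0(I-B^+B)=0$ is equivalent to the existence of real $B_1,B_2$ with $B_0=B_1B+BB_2$ (similarly for $C$). *)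

(* Defs.v *)
From HB Require Import structures.
From mathcomp Require Import all_boot all_order all_algebra.
From mathcomp Require Import boolp classical_sets reals.
Set Implicit Arguments.
Unset Strict Implicit.
Unset Printing Implicit Defensive.
Import GRing.Theory.
Local Open Scope ring_scope.

Record dual (R : Type) := Dual { std_part : R; dual_part : R }.

Section DualChoice.
Variable R : Type.
Definition pair_of_dual (x : dual R) : R * R := (std_part x, dual_part x).
Definition dual_of_pair (p : R * R) : dual R := Dual p.1 p.2.
Lemma pair_of_dualK : cancel pair_of_dual dual_of_pair.
Proof. by case. Qed.
End DualChoice.

HB.instance Definition _ (R : eqType) :=
  Equality.copy (dual R) (can_type (@pair_of_dualK R)).
HB.instance Definition _ (R : choiceType) :=
  Choice.copy (dual R) (can_type (@pair_of_dualK R)).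

Section DualRing.
Variable R : comNzRingType.
Implicit Types x y z : dual R.

Definition dual_zero : dual R := Dual 0 0.
Definition dual_one : dual R := Dual 1 0.
Definition dual_opp x := Dual (- std_part x) (- dual_part x).
Definition dual_add x y :=
  Dual (std_part x + std_part y) (dual_part x + dual_part y).
Definition dual_mul x y :=
  Dual (std_part x * std_part y)
       (std_part x * dual_part y + dual_part x * std_part y).

Fact dual_addA : associative dual_add.
Proof. by move=> x y z; rewrite /dual_add /= !addrA. Qed.
Fact dual_addC : commutative dual_add.
Proof.
by move=> x y; congr Dual; rewrite addrC.
Qed.
Fact dual_add0 : left_id dual_zero dual_add.
Proof. by case=> a b; rewrite /dual_add /= !add0r. Qed.
Fact dual_addN : left_inverse dual_zero dual_opp dual_add.
Proof. by case=> a b; rewrite /dual_add /= !addNr. Qed.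

HB.instance Definition _ :=
  GRing.isZmodule.Build (dual R) dual_addA dual_addC dual_add0 dual_addN.

Fact dual_mulA : associative dual_mul.
Proof.
move=> x y z; congr Dual => /=; first by rewrite mulrA.
by rewrite mulrDr mulrDl !mulrA addrA.
Qed.
Fact dual_mulC : commutative dual_mul.
Proof.
move=> x y; congr Dual => /=; first by rewrite mulrC.
by rewrite addrC [dual_part x * _]mulrC [std_part x * _]mulrC.
Qed.
Fact dual_mul1 : left_id dual_one dual_mul.
Proof. by case=> a b; rewrite /dual_mul /= !mul1r mul0r addr0. Qed.
Fact dual_mulD : left_distributive dual_mul +%R.
Proof.
by move=> x y z; congr Dual => /=; rewrite !mulrDl // addrACA.
Qed.
Fact dual_one_neq0 : dual_one != 0.
Proof. by apply/eqP => -[/eqP]; rewrite oner_eq0. Qed.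

HB.instance Definition _ := GRing.Zmodule_isComNzRing.Build (dual R)
  dual_mulA dual_mulC dual_mul1 dual_mulD dual_one_neq0.

Definition real_dual (a : R) : dual R := Dual a 0.

Fact real_dual_is_zmod_morphism : zmod_morphism real_dual.
Proof. by move=> a b; congr Dual => /=; rewrite subr0. Qed.
Fact real_dual_is_monoid_morphism : monoid_morphism real_dual.
Proof. by split=> // a b; congr Dual; rewrite /= mulr0 mul0r addr0. Qed.
HB.instance Definition _ := GRing.isZmodMorphism.Build R (dual R)
  real_dual real_dual_is_zmod_morphism.
HB.instance Definition _ := GRing.isMonoidMorphism.Build R (dual R)
  real_dual real_dual_is_monoid_morphism.

Definition eps : dual R := Dual 0 1.

Lemma eps_sqr : eps * eps = 0.
Proof. by congr Dual; rewrite /= !mul0r ?mulr0 ?addr0. Qed.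

Lemma eps_neq0 : eps != 0.
Proof. by apply/eqP => -[/eqP]; rewrite oner_eq0. Qed.

Lemma dualE x : x = real_dual (std_part x) + eps * real_dual (dual_part x).
Proof.
by case: x => a b; congr Dual; rewrite /= ?mul0r ?mul1r ?addr0 ?add0r.
Qed.

End DualRing.

Arguments eps {R}.

Notation "A %:DM" := (map_mx (@real_dual _) A)
  (at level 2, left associativity, format "A %:DM") : ring_scope.

Definition dualmx (R : comNzRingType) m n (A A0 : 'M[R]_(m, n)) :
  'M[dual R]_(m, n) := A%:DM + eps *: A0%:DM.

Lemma dualmxE (R : comNzRingType) m n (M : 'M[dual R]_(m, n)) :
  M = dualmx (map_mx (@std_part R) M) (map_mx (@dual_part R) M).
Proof. by apply/matrixP => i j; rewrite !mxE -dualE. Qed.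

Section BCInverse.
Variables (R : nzRingType) (m n s t : nat).
Implicit Types (A : 'M[R]_(m, n)) (B : 'M[R]_(n, s)) (C : 'M[R]_(t, m)).
Implicit Types X : 'M[R]_(n, m).

Definition is_bc_inverse A B C X : Prop :=
  [/\ C *m A *m X = C,
      X *m A *m B = B,
      exists Y1 : 'M[R]_(s, m), X = B *m Y1
    & exists Y2 : 'M[R]_(n, t), X = Y2 *m C].

Definition bc_invertible A B C : Prop := exists X, is_bc_inverse A B C X.

(* Equal to 0 when no (B, C)-inverse exists. *)
Definition bc_inverse A B C : 'M[R]_(n, m) :=
  xget 0 [set X | is_bc_inverse A B C X]%classic.

Lemma is_bc_inverse_unique A B C X X' :
  is_bc_inverse A B C X -> is_bc_inverse A B C X' -> X = X'.
Proof.
case=> _ XAB _ [Y2 XY2] [CAX' _ [Y1' X'Y1] _].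
transitivity (X *m A *m X'); last by rewrite X'Y1 mulmxA XAB.
by rewrite XY2 -!mulmxA [C *m _]mulmxA CAX'.
Qed.

Lemma bc_inverseP A B C :
  bc_invertible A B C -> is_bc_inverse A B C (bc_inverse A B C).
Proof. exact: xgetPex. Qed.

Lemma bc_inverse_eq A B C X : is_bc_inverse A B C X -> bc_inverse A B C = X.
Proof.
by move=> AX; apply: (is_bc_inverse_unique _ AX); apply: bc_inverseP; exists X.
Qed.

End BCInverse.

Definition reflexive_inverse (R : nzRingType) m n
    (M : 'M[R]_(m, n)) (X : 'M[R]_(n, m)) : Prop :=
  M *m X *m M = M /\ X *m M *m X = X.

(* Main.v *)
(* If B^ has an inner inverse B^ G^ B^ = B^, every term of the dual part of this
   identity other than the right-hand side starts or ends with B, so it is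
   killed by (I - B B+) _ (I - B+ B): this gives (1) => (3), because a
   (B^, C^)-inverse produces inner inverses of B^ and of C^.  Conversely, writing
   B0 = B1 B + B B2 and C0 = C1 C + C C2, the announced formula is checked to be a
   (B^, C^)-inverse for an arbitrary dual part A0 of A^; A0 = 0 gives (2). *)
Require Import Defs.
From HB Require Import structures.
From mathcomp Require Import all_boot all_order all_algebra.
From mathcomp Require Import boolp classical_sets reals.
From mathcomp Require Import ring.
Set Implicit Arguments.
Unset Strict Implicit.
Unset Printing Implicit Defensive.
Import GRing.Theory.
Local Open Scope ring_scope.

(** [X = B Y1] turns [X A B = B] into [B (Y1 A) B = B]; likewise [X = Y2 C] gives
    [C (A Y2) C = C]. *)
Lemma bc_inverse_inner (R : nzRingType) m n s t (A : 'M[R]_(m, n))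
    (B : 'M[R]_(n, s)) (C : 'M[R]_(t, m)) X :
    is_bc_inverse A B C X ->
  (exists G, B *m G *m B = B) /\ (exists G, C *m G *m C = C).
Proof.
case=> CAX XAB [Y1 XY1] [Y2 XY2]; split.
  by exists (Y1 *m A); rewrite !mulmxA -XY1.
by exists (A *m Y2); rewrite -!mulmxA -XY2 mulmxA.
Qed.

Section DualMatrix.
Variable R : comNzRingType.

Lemma dualmx_real m n (A : 'M[R]_(m, n)) : A%:DM = dualmx A 0.
Proof. by rewrite /dualmx map_mx0 scaler0 addr0. Qed.

Lemma dualmxij m n (A A0 : 'M[R]_(m, n)) i j :
  dualmx A A0 i j = Dual (A i j) (A0 i j).
Proof. by rewrite !mxE [RHS]dualE. Qed.

Lemma dualmx_inj m n (A A0 B B0 : 'M[R]_(m, n)) :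
  dualmx A A0 = dualmx B B0 -> A = B /\ A0 = B0.
Proof.
by move=> /matrixP eqAB; split; apply/matrixP => i j;
  move: (eqAB i j); rewrite !dualmxij => -[].
Qed.

Lemma mul_dualmx m n p (A A0 : 'M[R]_(m, n)) (B B0 : 'M[R]_(n, p)) :
  dualmx A A0 *m dualmx B B0 = dualmx (A *m B) (A *m B0 + A0 *m B).
Proof.
rewrite /dualmx mulmxDl !mulmxDr -!scalemxAl -!scalemxAr scalerA eps_sqr.
by rewrite scale0r addr0 map_mxD !map_mxM scalerDr addrA.
Qed.

Local Notation std_mx := (map_mx (@std_part R)).

Lemma std_dualmx m n (A A0 : 'M[R]_(m, n)) : std_mx (dualmx A A0) = A.
Proof. by apply/matrixP => i j; rewrite mxE dualmxij. Qed.

Lemma std_mxM m n p (A : 'M[dual R]_(m, n)) (B : 'M[dual R]_(n, p)) :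
  std_mx (A *m B) = std_mx A *m std_mx B.
Proof. by rewrite [A]dualmxE [B]dualmxE mul_dualmx !std_dualmx. Qed.

Section InnerInverse.
Variables (m n : nat) (B B0 : 'M[R]_(m, n)).

Lemma dual_inner_inverse_cond (Bp : 'M[R]_(n, m)) (G : 'M[dual R]_(n, m)) :
    B *m Bp *m B = B ->
    dualmx B B0 *m G *m dualmx B B0 = dualmx B B0 ->
  (1%:M - B *m Bp) *m B0 *m (1%:M - Bp *m B) = 0.
Proof.
(* [B0] is replaced by the dual part of the triple product, with [G] split into standard and dual
   parts. *)
move=> BBpB; rewrite [G]dualmxE !mul_dualmx => /dualmx_inj[_ <-].
have kBl : (1%:M - B *m Bp) *m B = 0 by rewrite mulmxBl mul1mx BBpB subrr.
have kBr : B *m (1%:M - Bp *m B) = 0 by rewrite mulmxBr mulmx1 mulmxA BBpB subrr.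
move: (1%:M - B *m Bp) (1%:M - Bp *m B) kBl kBr => K L kBl kBr.
rewrite mulmxDr mulmxDl -(mulmxA B) (mulmxA K B) kBl !mul0mx add0r.
by rewrite -!mulmxA kBr !mulmx0.
Qed.

(** With [K = I - B Bp], the condition reads [K B0 = K B0 Bp B], while [B0 = K B0 + B Bp B0]. *)
Lemma inner_inverse_cond_split (Bp : 'M[R]_(n, m)) :
    (1%:M - B *m Bp) *m B0 *m (1%:M - Bp *m B) = 0 ->
  exists (B1 : 'M[R]_m) (B2 : 'M[R]_n), B0 = B1 *m B + B *m B2.
Proof.
rewrite mulmxBr mulmx1 mulmxA => /subr0_eq cond.
exists ((1%:M - B *m Bp) *m B0 *m Bp), (Bp *m B0).
by rewrite -cond mulmxBl mul1mx !mulmxA subrK.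
Qed.

End InnerInverse.

Section DualBCInverse.
Variables (m n s t : nat).
Variables (A A0 : 'M[R]_(m, n)) (B B0 : 'M[R]_(n, s)) (C C0 : 'M[R]_(t, m)).

(** Taking standard parts is multiplicative, so the defining equations and their witnesses descend
    to real matrices. *)
Lemma dual_bc_inverse_std (X : 'M[dual R]_(n, m)) :
    is_bc_inverse (dualmx A A0) (dualmx B B0) (dualmx C C0) X ->
  is_bc_inverse A B C (std_mx X).
Proof.
case=> CAX XAB [Y1 XY1] [Y2 XY2].
move: (congr1 std_mx CAX) (congr1 std_mx XAB) (congr1 std_mx XY1).
move: (congr1 std_mx XY2); rewrite !std_mxM !std_dualmx => XY2' CAX' XAB' XY1'.
by split=> //; [exists (std_mx Y1) | exists (std_mx Y2)].
Qed.

(** Since B^ factors as [(I + eps B1) B (I + eps B2)], and C^ similarly, only [B1] moves the column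
    space of B^ and only [C2] the row space of C^; [B2] and [C1] are absorbed by the witnesses. The
    term [- X A0 X] is the first-order variation of an inverse. *)
Lemma dual_bc_inverse_lift (X : 'M[R]_(n, m))
    (B1 : 'M[R]_n) (B2 : 'M[R]_s) (C1 : 'M[R]_t) (C2 : 'M[R]_m) :
    is_bc_inverse A B C X ->
    B0 = B1 *m B + B *m B2 -> C0 = C1 *m C + C *m C2 ->
  is_bc_inverse (dualmx A A0) (dualmx B B0) (dualmx C C0)
    (dualmx X (- (X *m A0 *m X) + (1%:M - X *m A) *m B1 *m X
               + X *m C2 *m (1%:M - A *m X))).
Proof.
pose expand := (@mulmxDr R, @mulmxDl R, @mulmxN R, @mulNmx R, @mul1mx R,
                @mulmx1 R, @mulmxA R).
move=> [CAX XAB [Y1 XY1] [Y2 XY2]] -> ->.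
(* [expand] associates products to the left, so the equations are also needed behind an arbitrary
   left factor [M]. *)
have CAXr q (M : 'M_(q, t)) : M *m C *m A *m X = M *m C.
  by rewrite -!mulmxA (mulmxA C) CAX.
have XABr q (M : 'M_(q, n)) : M *m X *m A *m B = M *m B.
  by rewrite -!mulmxA (mulmxA X) XAB.
have BY1r q (M : 'M_(q, n)) : M *m B *m Y1 = M *m X by rewrite -mulmxA -XY1.
have Y2Cr q (M : 'M_(q, n)) : M *m Y2 *m C = M *m X by rewrite -mulmxA -XY2.
split.
- rewrite !mul_dualmx; congr dualmx => //; rewrite !expand CAX CAXr.
  by apply/matrixP => i j; rewrite !mxE; ring.
- rewrite !mul_dualmx; congr dualmx => //; rewrite !expand XAB !XABr.
  by apply/matrixP => i j; rewrite !mxE; ring.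
(* The dual part [Z] solves [B Z + B0 Y1 = X0], where [X0] is the dual part of the candidate:
   [B0 Y1 = B1 X + B B2 Y1] cancels [B1 X], and [X = B Y1] lets [B] be factored out on the left. *)
- exists (dualmx Y1 (- (Y1 *m A0 *m X) - Y1 *m A *m B1 *m X
                     + Y1 *m C2 *m (1%:M - A *m X) - B2 *m Y1)).
  rewrite mul_dualmx -XY1; congr dualmx; rewrite !expand BY1r -!XY1.
  by apply/matrixP => i j; rewrite !mxE; ring.
(* Symmetrically, [Z C + Y2 C0 = X0] with [Y2 C0 = Y2 C1 C + X C2]. *)
- exists (dualmx Y2 (- (X *m A0 *m Y2) + (1%:M - X *m A) *m B1 *m Y2
                     - X *m C2 *m A *m Y2 - Y2 *m C1)).
  rewrite mul_dualmx -XY2; congr dualmx; rewrite !expand !Y2Cr -!XY2.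
  by apply/matrixP => i j; rewrite !mxE; ring.
Qed.

End DualBCInverse.
End DualMatrix.

Theorem proposition4p1 (R : realType) (m n s t : nat)
    (A A0 : 'M[R]_(m, n)) (B B0 : 'M[R]_(n, s)) (C C0 : 'M[R]_(t, m))
    (Bp : 'M[R]_(s, n)) (Cp : 'M[R]_(m, t))
    (hBp : reflexive_inverse B Bp) (hCp : reflexive_inverse C Cp) :
  [<-> bc_invertible (dualmx A A0) (dualmx B B0) (dualmx C C0);
       bc_invertible A%:DM (dualmx B B0) (dualmx C C0);
       [/\ bc_invertible A B C,
           (1%:M - B *m Bp) *m B0 *m (1%:M - Bp *m B) = 0
         & (1%:M - C *m Cp) *m C0 *m (1%:M - Cp *m C) = 0]]
  /\
  (bc_invertible (dualmx A A0) (dualmx B B0) (dualmx C C0) ->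
   [/\ exists (B1 : 'M[R]_n) (B2 : 'M[R]_s), B0 = B1 *m B + B *m B2,
       exists (C1 : 'M[R]_t) (C2 : 'M[R]_m), C0 = C1 *m C + C *m C2
     & forall (B1 : 'M[R]_n) (B2 : 'M[R]_s) (C1 : 'M[R]_t) (C2 : 'M[R]_m),
         B0 = B1 *m B + B *m B2 -> C0 = C1 *m C + C *m C2 ->
         let X := bc_inverse A B C in
         bc_inverse A%:DM (dualmx B B0) (dualmx C C0) =
           X%:DM + eps *: ((1%:M - X *m A) *m B1 *m X)%:DM
                 + eps *: (X *m C2 *m (1%:M - A *m X))%:DM
         /\
         bc_inverse (dualmx A A0) (dualmx B B0) (dualmx C C0) =
           X%:DM - eps *: (X *m A0 *m X)%:DM
                 + eps *: ((1%:M - X *m A) *m B1 *m X)%:DM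
                 + eps *: (X *m C2 *m (1%:M - A *m X))%:DM]).
Proof.
set cond3 := and3 _ _ _.
have nec A' : bc_invertible (dualmx A A') (dualmx B B0) (dualmx C C0) -> cond3.
  case=> X AX; have [[G BGB] [H CHC]] := bc_inverse_inner AX; split.
  - by eexists; apply: dual_bc_inverse_std AX.
  - exact: dual_inner_inverse_cond hBp.1 BGB.
  - exact: dual_inner_inverse_cond hCp.1 CHC.
have suf A' : cond3 -> bc_invertible (dualmx A A') (dualmx B B0) (dualmx C C0).
  case=> -[X AX] /inner_inverse_cond_split[B1 [B2 B0E]].
  move=> /inner_inverse_cond_split[C1 [C2 C0E]].
  by eexists; apply: dual_bc_inverse_lift AX B0E C0E.
(* [A%:DM] has dual part 0, so (2) is the case [A' = 0], and (1) => (2) passes through (3). *)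
rewrite dualmx_real; split; first by tfae=> [/nec/suf|/nec|/suf].
move=> /nec[AX condB condC]; split.
- exact: inner_inverse_cond_split condB.
- exact: inner_inverse_cond_split condC.
move=> B1 B2 C1 C2 B0E C0E X.
have AXP := bc_inverseP AX.
(* By uniqueness, it suffices that each formula defines an inverse. *)
split; apply: bc_inverse_eq.
  have := dual_bc_inverse_lift 0 AXP B0E C0E.
  by rewrite mulmx0 mul0mx oppr0 add0r /dualmx map_mxD scalerDr addrA.
have := dual_bc_inverse_lift A0 AXP B0E C0E.
by rewrite /dualmx !map_mxD map_mxN !scalerDr scalerN !addrA.
Qed.
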